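(* Let $n \ge 0$ be an integer and let $u:\{-n,\dots,n\}\to\mathbb{R}$ be a symmetric function (that is, $u(-k)=u(k)$ for all $k$) with normalization $\sum_{k=-n}^{n}u(k)=1$. Then $$\sup_{0\neq f\in\ell^2(\mathbb{Z})}\frac{\|\nabla(f*u)\|_{\ell^2(\mathbb{Z})}}{\|f\|_{\ell^2(\mathbb{Z})}}\;\geq\;\frac{2}{2n+1},$$ with equality if and only if $u$ is the constant function $u(k)=1/(2n+1)$ for all $k\in\{-n,\dots,n\}$.
   Context: Functions $f\in\ell^2(\mathbb{Z})$ are complex-valued. The function $u$ is extended by $0$ to all of $\mathbb{Z}$, and $(f*u)(k)=\sum_{m\in\mathbb{Z}}f(k-m)u(m)$. The discrete derivative of $g:\mathbb{Z}\to\mathbb{C}$ is $(\nabla g)(k)=g(k+1)-g(k)$. *)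

(* Defs.v *)
From HB Require Import structures.
From mathcomp Require Import all_boot all_order all_algebra.
From mathcomp Require Import all_classical all_reals all_analysis.
From mathcomp Require Import complex.

Set Implicit Arguments.
Unset Strict Implicit.
Unset Printing Implicit Defensive.

Import Order.TTheory GRing.Theory Num.Theory.

Local Open Scope classical_set_scope.
Local Open Scope ring_scope.
Local Open Scope complex_scope.

(* Only the values of [u] on {-n, ..., n} are used. *)
Definition zero_extension (R : realType) (n : nat) (u : int -> R) : int -> R[i] :=
  fun k => if `|k| <= n%:Z then (u k)%:C else 0.

(* [\sum_(m \in _)] is 0 when the summand has infinite support; this never
   happens when [v] is a [zero_extension]. *)
Definition convolution (R : realType) (f v : int -> R[i]) : int -> R[i] :=
  fun k => \sum_(m \in [set: int]) f (k - m) * v m.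

Definition nabla (R : realType) (g : int -> R[i]) : int -> R[i] :=
  fun k => g (k + 1) - g k.

(* Takes the value +oo when [f] is not square-summable. *)
Definition l2norm (R : realType) (f : int -> R[i]) : \bar R :=
  sqrte (\esum_(k in [set: int]) (ComplexField.Normc.normc (f k) ^+ 2)%:E).

Definition l2 (R : realType) : set (int -> R[i]) :=
  [set f | (l2norm f < +oo)%E].

Definition sup_ratio (R : realType) (n : nat) (u : int -> R) : \bar R :=
  ereal_sup
    [set (l2norm (nabla (convolution f (zero_extension n u))) / l2norm f)%E
      | f in [set f | l2 f /\ f <> (fun=> 0)]].

(* Main.v *)
Require Import Defs.
From mathcomp Require Import all_boot all_order all_algebra.
From mathcomp Require Import all_classical all_reals all_analysis.
From mathcomp Require Import complex.
From mathcomp Require Import zify ring lra.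

(** Write [N = 2n + 1], and [S] for the sum of the squares of the values of [u].

    Lower bound. The supremum is tested on a square wave [f] of half-period [N]:
    constant of modulus 1 on blocks of length [N], with alternating signs. Its
    discrete derivative is a sum of point masses of weight +2 or -2 placed at
    distance [N] from each other, so [nabla (f * u) = (nabla f) * u] consists of
    translates of [2u] and [-2u]. The support of [u] has at most [N] points, so
    these translates do not overlap, and on each block the squared norm of
    [nabla (f * u)] is [4S] while that of [f] is [N]. The infinite wave is not in
    l2; cutting it after [L + 1] blocks loses only a bounded number of blocks, and
    letting [L] grow gives [4S <= c^2 N] for every upper bound [c] of the ratios
    ([sum_sqr_le_of_sup_ratio_le]).

    Since the values of [u] sum to 1, the sum of the squares of their deviations
    from the mean [1/N] is [S - 1/N] ([sum_sqr_sub_mean]). Hence [S >= 1/N], which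
    with the previous inequality gives [c >= 2/N]; and if [c = 2/N] is an upper
    bound, then [S <= 1/N], so all the deviations vanish and [u] is constant.

    Upper bound. If [u] is constant, the sum defining [nabla (f * u)] telescopes
    to [(f (k + n + 1) - f (k - n)) / N], a difference of two translates of [f]
    divided by [N], whose norm is at most [2/N] times that of [f]
    ([sup_ratio_const_le]). *)

Import Order.TTheory GRing.Theory Num.Theory.

Local Open Scope ring_scope.

(** * Squared l2 norms *)

Definition sqnormc {R : realType} (z : R[i]%C) : R :=
  ComplexField.Normc.normc z ^+ 2.

(** The square of [l2norm], for which upper and lower bounds follow from bounds on
    the summands. *)
Definition energy {R : realType} (f : int -> R[i]%C) : \bar R :=
  \esum_(k in [set: int]) (sqnormc (f k))%:E.

Lemma sqnormcE (R : realType) (z : R[i]%C) :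
  sqnormc z = complex.Re z ^+ 2 + complex.Im z ^+ 2.
Proof.
by case: z => a b; rewrite /sqnormc /= sqr_sqrtr // addr_ge0 ?sqr_ge0.
Qed.

Lemma sqnormc_ge0 (R : realType) (z : R[i]%C) : 0 <= sqnormc z.
Proof. exact: sqr_ge0. Qed.

Lemma sqnormc_real (R : realType) (x : R) : sqnormc x%:C%C = x ^+ 2.
Proof. by rewrite sqnormcE /= expr0n addr0. Qed.

Lemma sqnormcM_real (R : realType) (z : R[i]%C) (x : R) :
  sqnormc (z * x%:C%C) = sqnormc z * x ^+ 2.
Proof. by case: z => a b; rewrite !sqnormcE /=; ring. Qed.

(** By the parallelogram identity, the difference of the two sides is the squared
    modulus of [z + w]. *)
Lemma sqnormcB_le (R : realType) (z w : R[i]%C) :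
  sqnormc (z - w) <= 2 * (sqnormc z + sqnormc w).
Proof.
case: z w => [a b] [c d]; rewrite !sqnormcE /= -subr_ge0.
have -> : 2 * (a ^+ 2 + b ^+ 2 + (c ^+ 2 + d ^+ 2)) -
  ((a - c) ^+ 2 + (b - d) ^+ 2) = (a + c) ^+ 2 + (b + d) ^+ 2 by ring.
by rewrite addr_ge0 ?sqr_ge0.
Qed.

Lemma energy_ge0 (R : realType) (f : int -> R[i]%C) : (0 <= energy f)%E.
Proof. by apply: esum_ge0 => k _; rewrite lee_fin sqnormc_ge0. Qed.

Lemma sum_le_energy (R : realType) (f : int -> R[i]%C) (I : finType)
    (h : I -> int) : injective h ->
  ((\sum_i sqnormc (f (h i)))%:E <= energy f)%E.
Proof.
move=> h_inj; apply: esum_ge; exists [set` [seq h i | i : I]]%classic.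
  by split=> //; exact: finite_seq.
rewrite fsumEFin; last exact: finite_seq.
rewrite -fsbig_seq; last by rewrite map_inj_uniq ?enum_uniq.
by rewrite big_image.
Qed.

Lemma energy_fin_support (R : realType) (f : int -> R[i]%C) (I : finType)
    (h : I -> int) : injective h ->
  (forall k, (forall i, k != h i) -> f k = 0) ->
  energy f = (\sum_i sqnormc (f (h i)))%:E.
Proof.
move=> h_inj f0; pose s := [seq h i | i : I].
transitivity (\esum_(k in [set` s]%classic) (sqnormc (f k))%:E)%E.
  rewrite [RHS]esum_mkcond; apply: eq_esum => k _; case: ifPn => // ks.
  rewrite f0 ?sqnormcE /= ?expr0n ?addr0 // => i; apply: contraNneq ks => ->.
  by rewrite inE /= map_f ?mem_enum.
have fin_s : finite_set [set` s]%classic by exact: finite_seq.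
rewrite esum_fset //; last by move=> i _; rewrite lee_fin sqnormc_ge0.
rewrite fsumEFin // -fsbig_seq; last by rewrite map_inj_uniq ?enum_uniq.
by rewrite big_image.
Qed.

Lemma energy_shift (R : realType) (f : int -> R[i]%C) (a : int) :
  energy (fun k => f (k + a)) = energy f.
Proof.
rewrite /energy; symmetry.
apply: (@reindex_esum R int int setT setT (fun k => k + a)
  (fun k => (sqnormc (f k))%:E)).
split=> [//|x y _ _ /addIr //|y _]; by exists (y - a); rewrite ?subrK.
Qed.

Lemma energyZ (R : realType) (f : int -> R[i]%C) (x : R) :
  energy (fun k => f k * x%:C%C) = ((x ^+ 2)%:E * energy f)%E.
Proof.
rewrite /energy /esum -ereal_supZl ?sqr_ge0 //; last first.
  apply/set0P; exists (\sum_(k \in set0) (sqnormc (f k))%:E)%E.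
  by exists set0 => //; exact: fsets_set0.
congr ereal_sup; rewrite image_comp; apply: eq_imagel => A _ /=.
rewrite ge0_mule_fsumr; last by move=> k; rewrite lee_fin sqnormc_ge0.
by apply: eq_fsbigr => k _; rewrite sqnormcM_real mulrC EFinM.
Qed.

Lemma energyB_le (R : realType) (f g : int -> R[i]%C) :
  (energy (fun k => f k - g k)%R <= 2%:E * (energy f + energy g))%E.
Proof.
rewrite mule_natl mule2n.
rewrite /energy -esumD; [|by move=> k _; rewrite lee_fin sqnormc_ge0..].
rewrite -esumD; [|by move=> k _; rewrite lee_fin addr_ge0 ?sqnormc_ge0..].
apply: le_esum => k _; rewrite -!EFinD lee_fin.
by apply: le_trans (sqnormcB_le R _ _) _; rewrite mulr_natl mulr2n.
Qed.

(** The quotient in [sup_ratio] is taken in the extended reals. For [f] nonzero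
    and square-summable its denominator is a positive real number, and the bound
    on the quotient can be squared and cleared of its denominator. *)
Lemma ratio_leE (R : realType) (f g : int -> R[i]%C) (c : R) :
  0 <= c -> l2 f -> f <> (fun=> 0) ->
  (l2norm g / l2norm f <= c%:E)%E = (energy g <= (c ^+ 2)%:E * energy f)%E.
Proof.
move=> c0; rewrite /l2 /l2norm /= -!/(energy _) => f_fin f_neq0.
have [e e_def e_gt0] : exists2 e, energy f = e%:E & 0 < e.
  have := energy_ge0 R f.
  case E : (energy f) f_fin => [e| |] //= _; rewrite lee_fin => e_ge0.
  exists e => //; rewrite lt_neqAle e_ge0 andbT eq_sym; apply/eqP => e0.
  apply: f_neq0; apply/funext => k; apply: ComplexField.Normc.eq0_normc.
  apply/eqP; rewrite -sqrf_eq0 eq_le sqr_ge0 andbT.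
  have k_inj : injective (fun _ : unit => k) by move=> [] [].
  have := sum_le_energy R f unit (fun=> k) k_inj.
  by rewrite big_const card_unit /= addr0 E e0 lee_fin.
rewrite e_def /= inver gt_eqF ?sqrtr_gt0 // lee_pdivrMr ?sqrtr_gt0 //.
rewrite -[X in (_ <= X%:E * _)%E](ger0_norm c0) -sqrtr_sqr -EFinM.
rewrite -sqrtrM ?sqr_ge0 // -[(Num.sqrt _)%:E]/(sqrte (_%:E)) lee_sqrt //.
by rewrite lee_fin mulr_ge0 ?sqr_ge0 // ltW.
Qed.

(** * The supremum and the convolution *)

Lemma sup_ratio_leP (R : realType) (n : nat) (u : int -> R) (c : R) : 0 <= c ->
  (sup_ratio n u <= c%:E)%E <->
  (forall f, l2 f -> f <> (fun=> 0) ->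
     (energy (nabla (convolution f (zero_extension n u)))
        <= (c ^+ 2)%:E * energy f)%E).
Proof.
move=> c0; split=> [le_c f f2 f0|H].
  rewrite -ratio_leE //; apply: le_trans le_c.
  by apply: ereal_sup_ubound; exists f.
by apply: ge_ereal_sup => _ [f [f2 f0] <-]; rewrite ratio_leE //; exact: H.
Qed.

Lemma convolutionE (R : realType) (n : nat) (u : int -> R) (f : int -> R[i]%C)
    (k : int) :
  convolution f (zero_extension n u) k =
  \sum_(i < (2 * n + 1)%N) f (k - (i%:Z - n%:Z)) * (u (i%:Z - n%:Z))%:C%C.
Proof.
pose h (i : 'I_(2 * n + 1)) : int := i%:Z - n%:Z.
have h_inj : injective h by move=> i j; rewrite /h => ?; apply/val_inj => /=; lia.
rewrite /convolution (fsbigE [seq h i | i : 'I_(2 * n + 1)]) //=; first last.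
- move=> m _ m_notin; rewrite /zero_extension ifF ?mulr0 //.
  apply: contraNF m_notin => m_le; apply/mapP.
  have m_lt : (absz (m + n%:Z)%R < 2 * n + 1)%N by lia.
  by exists (Ordinal m_lt); rewrite ?mem_enum // /h /=; lia.
- by rewrite map_inj_uniq ?enum_uniq.
rewrite big_mkcond /= big_image /=; apply: eq_bigr => i _.
rewrite in_setT /zero_extension ifT //; have := ltn_ord i; rewrite /h; lia.
Qed.

(** * The test function *)

(** The sign alternates between consecutive blocks of length [N]; the wave is cut
    to the [L] blocks that cover [0, ..., L * N - 1] so that it lies in l2. *)
Definition square_wave (R : realType) (N L : nat) : int -> R[i]%C := fun k =>
  if k is Posz m then if (m < L * N)%N then ((-1) ^+ (m %/ N))%:C%C else 0
  else 0.

Lemma square_waveE (R : realType) (N L j d : nat) : (j < L)%N -> (d < N)%N ->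
  square_wave R N L (j * N + d)%N%:Z = ((-1) ^+ j)%:C%C.
Proof.
move=> jL dN; rewrite /square_wave ifT; last by nia.
by rewrite divnMDl ?divn_small ?addn0 //; lia.
Qed.

Lemma energy_square_wave (R : realType) (N L : nat) :
  energy (square_wave R N L) = (L * N)%N%:R%:E.
Proof.
rewrite (energy_fin_support R _ _ (fun i : 'I_(L * N) => i%:Z)).
- rewrite (eq_bigr (fun=> 1)) ?sumr_const ?card_ord // => i _.
  by rewrite /square_wave ltn_ord sqnormc_real sqrr_sign.
- by move=> i j [] /val_inj.
- case=> // m m_notin; rewrite /square_wave; case: ifP => // m_lt.
  by have := m_notin (Ordinal m_lt); rewrite eqxx.
Qed.

(** The jumps of the wave inside its support sit between [j.+1 * N - 1] and
    [j.+1 * N], and the evaluation point is the translate of [i - n] by the former.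
    A term [i'] of the convolution sees a jump only if it compares the values of
    the wave at [j.+1 * N + (i - i') - 1] and [j.+1 * N + (i - i')], where
    [i - i'] has modulus less than [N]: both values are on block [j.+1] for
    [i' < i], both are on block [j] for [i < i'], and only [i' = i] remains. *)
Lemma nabla_conv_square_wave (R : realType) (n L j : nat) (u : int -> R)
    (i : 'I_(2 * n + 1)) : (j < L)%N ->
  nabla (convolution (square_wave R (2 * n + 1) L.+1) (zero_extension n u))
    ((j.+1 * (2 * n + 1) + i)%N%:Z - 1 - n%:Z) =
  (2 * (-1) ^+ j.+1 * u (i%:Z - n%:Z))%:C%C.
Proof.
move=> jL; set N := (2 * n + 1)%N in i *.
rewrite /nabla !convolutionE -/N -sumrB (bigD1 i) //= big1 ?addr0.
  rewrite (_ : _ + 1 - _ = (j.+1 * N + 0)%N%:Z); last by lia.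
  rewrite (_ : _ - _ - _ - _ = (j * N + N.-1)%N%:Z); last by rewrite /N; lia.
  rewrite !square_waveE -?mulrBl -?rmorphB -?rmorphM /=; [|by rewrite /N; lia..].
  congr (_%:C%C); rewrite exprS; ring.
(* The other terms compare two values on the same block. *)
move=> i' i'_neq_i; rewrite -mulrBl; apply/eqP; rewrite mulf_eq0 subr_eq0.
apply/orP; left; apply/eqP; have := ltn_ord i; have := ltn_ord i'.
have : (i' < i)%N || (i < i')%N by rewrite -neq_ltn.
case/orP => cmp i'N iN.
  rewrite (_ : _ + 1 - _ = (j.+1 * N + (i - i'))%N%:Z); last by lia.
  rewrite (_ : _ - _ - _ - _ = (j.+1 * N + (i - i').-1)%N%:Z); last by lia.
  by rewrite !square_waveE //; lia.
rewrite (_ : _ + 1 - _ = (j * N + (N + i - i'))%N%:Z); last by lia.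
rewrite (_ : _ - _ - _ - _ = (j * N + (N + i - i').-1)%N%:Z); last by lia.
by rewrite !square_waveE //; lia.
Qed.

(** Only the [L] interior jumps of the wave with [L.+1] blocks are counted. The
    pairs (jump, offset) give distinct points, because the offset is less than the
    distance between consecutive jumps. *)
Lemma nabla_conv_square_wave_energy (R : realType) (n L : nat) (u : int -> R) :
  ((L%:R * (4 * \sum_(i < (2 * n + 1)%N) u (i%:Z - n%:Z) ^+ 2))%:E <=
   energy (nabla (convolution (square_wave R (2 * n + 1) L.+1)
     (zero_extension n u))))%E.
Proof.
pose h (p : 'I_L * 'I_(2 * n + 1)) : int :=
  (p.1.+1 * (2 * n + 1) + p.2)%N%:Z - 1 - n%:Z.
have h_inj : injective h.
  move=> [j i] [j' i']; rewrite /h /= => heq.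
  have {}heq : (j * (2 * n + 1) + i = j' * (2 * n + 1) + i')%N by lia.
  have N_gt0 : (0 < 2 * n + 1)%N by lia.
  have := heq; move/(congr1 (divn^~ (2 * n + 1)%N)).
  rewrite !divnMDl // !divn_small ?ltn_ord // !addn0 => jj.
  move: heq; rewrite jj => /addnI ii.
  by congr pair; apply/val_inj.
apply: le_trans (sum_le_energy R _ _ h h_inj); rewrite lee_fin.
rewrite -(pair_bigA _ (fun j i => sqnormc (nabla _ (h (j, i))))) /=.
rewrite [leRHS](eq_bigr (fun=> 4 * \sum_(i < (2 * n + 1)%N) u (i%:Z - n%:Z) ^+ 2)).
  by rewrite sumr_const card_ord mulr_natl.
move=> j _; rewrite mulr_sumr; apply: eq_bigr => i _.
rewrite /h nabla_conv_square_wave // sqnormc_real !exprMn sqrr_sign mulr1.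
by congr (_ * _); rewrite expr2 -natrM.
Qed.

(** Division by [L], which tends to infinity. *)
Lemma le_of_nat_multiples (R : realType) (a b : R) :
  (forall L : nat, L%:R * a <= L.+1%:R * b) -> a <= b.
Proof.
move=> H; rewrite leNgt; apply/negP => b_lt_a.
have b_ge0 : 0 <= b by have := H 0%N; rewrite mul0r mul1r.
have := H (Num.bound (b / (a - b))); apply/negP; rewrite -ltNge.
set L := Num.bound _.
have : b / (a - b) < L%:R.
  by rewrite archi_boundP // divr_ge0 // subr_ge0 ltW.
rewrite ltr_pdivrMr ?subr_gt0 // -natr1; nra.
Qed.

(** * The lower bound and the equality case *)

(** Compares [energy_square_wave] with [nabla_conv_square_wave_energy] for [L.+1]
    blocks and lets [L] tend to infinity. *)
Lemma sum_sqr_le_of_sup_ratio_le (R : realType) (n : nat) (u : int -> R) (c : R) :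
  0 <= c -> (sup_ratio n u <= c%:E)%E ->
  4 * \sum_(i < (2 * n + 1)%N) u (i%:Z - n%:Z) ^+ 2
    <= c ^+ 2 * (2 * n + 1)%N%:R.
Proof.
move=> c0 /sup_ratio_leP => /(_ c0) H; apply: le_of_nat_multiples => L.
have E := energy_square_wave R (2 * n + 1) L.+1.
have N_gt0 : (0 < 2 * n + 1)%N by lia.
rewrite -lee_fin; apply: le_trans (nabla_conv_square_wave_energy R n L u) _.
apply: le_trans (H _ _ _) _.
- by rewrite /l2 /l2norm /= -/(energy _) E ltry.
- move=> wave0; have := square_waveE R (2 * n + 1) L.+1 0 0 isT N_gt0.
  by rewrite wave0 expr0 => /eqP; rewrite eq_sym oner_eq0.
- by rewrite E -EFinM lee_fin natrM mulrCA.
Qed.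

(** The variance identity. It quantifies the Cauchy-Schwarz inequality between [v]
    and the constant function 1, and so gives both the lower bound [1 / N] for the
    sum of squares and the case of equality. *)
Lemma sum_sqr_sub_mean (R : realType) (N : nat) (v : 'I_N -> R) :
  (0 < N)%N -> \sum_i v i = 1 ->
  \sum_i (v i - 1 / N%:R) ^+ 2 = \sum_i v i ^+ 2 - 1 / N%:R.
Proof.
move=> N0 v1; have N_neq0 : N%:R != 0 :> R by rewrite pnatr_eq0 -lt0n.
under eq_bigr do rewrite sqrrB -mulrnAl.
rewrite big_split sumrB /= -mulr_suml sumrMnl v1 sumr_const card_ord.
by rewrite -[X in _ + X]mulr_natr; field.
Qed.

Lemma eq_mean_of_sum_sqr_le (R : realType) (N : nat) (v : 'I_N -> R) :
  (0 < N)%N -> \sum_i v i = 1 -> \sum_i v i ^+ 2 <= 1 / N%:R ->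
  forall i, v i = 1 / N%:R.
Proof.
move=> N0 v1 v2 i; apply/eqP; rewrite -subr_eq0 -sqrf_eq0 eq_le sqr_ge0 andbT.
apply: (@le_trans _ _ (\sum_i (v i - 1 / N%:R) ^+ 2)).
  by rewrite (bigD1 i) //= lerDl sumr_ge0 // => j _; exact: sqr_ge0.
by rewrite sum_sqr_sub_mean // subr_le0.
Qed.

Lemma const_of_sup_ratio_le (R : realType) (n : nat) (u : int -> R) :
  \sum_(i < (2 * n + 1)%N) u (i%:Z - n%:Z) = 1 ->
  (sup_ratio n u <= (2 / (2 * n + 1)%N%:R)%:E)%E ->
  forall k : int, `|k| <= n%:Z -> u k = 1 / (2 * n + 1)%N%:R.
Proof.
move=> u_sum sup_le k k_le; set N := (2 * n + 1)%N in u_sum sup_le *.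
have N_gt0 : (0 < N)%N by rewrite /N; lia.
have k_lt : (absz (k + n%:Z)%R < N)%N by rewrite /N; lia.
have -> : k = (Ordinal k_lt)%:Z - n%:Z by rewrite /=; lia.
apply: (eq_mean_of_sum_sqr_le R N (fun i : 'I_N => u (i%:Z - n%:Z))) => //.
have := sum_sqr_le_of_sup_ratio_le R n u (2 / N%:R).
rewrite divr_ge0 // => /(_ isT sup_le); rewrite -/N.
have N_neq0 : N%:R != 0 :> R by rewrite pnatr_eq0 -lt0n.
have -> : (2 / N%:R) ^+ 2 * N%:R = 4 * (1 / N%:R) :> R by field.
by rewrite ler_pM2l // ltr0n.
Qed.

Lemma sup_ratio_upper_bound_ge (R : realType) (n : nat) (u : int -> R) (c : R) :
  \sum_(i < (2 * n + 1)%N) u (i%:Z - n%:Z) = 1 ->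
  0 <= c -> (sup_ratio n u <= c%:E)%E -> 2 / (2 * n + 1)%N%:R <= c.
Proof.
move=> u_sum c0 /(sum_sqr_le_of_sup_ratio_le R n u c c0).
set N := (2 * n + 1)%N in u_sum *.
have N_gt0 : (0 < N)%N by rewrite /N; lia.
have Nr_gt0 : 0 < N%:R :> R by rewrite ltr0n.
set S := \sum_(i < _) _ => S_le.
have S_ge : 1 / N%:R <= S.
  rewrite -subr_ge0.
  rewrite -(sum_sqr_sub_mean R N (fun i : 'I_N => u (i%:Z - n%:Z))) //.
  by apply: sumr_ge0 => i _; exact: sqr_ge0.
rewrite -(ler_pXn2r (n := 2)) ?nnegrE ?divr_ge0 //.
rewrite -(ler_pM2r Nr_gt0); apply: le_trans S_le.
have -> : (2 / N%:R) ^+ 2 * N%:R = 4 * (1 / N%:R) :> R by field; rewrite gt_eqF.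
by rewrite ler_pM2l // ltr0n.
Qed.

(** * The upper bound for constant functions *)

(** Convolution with a constant is a window sum; moving the window by one step adds
    a value of [f] at one end and removes one at the other. *)
Lemma nabla_conv_const (R : realType) (n : nat) (u : int -> R)
    (f : int -> R[i]%C) (k : int) :
  (forall m : int, `|m| <= n%:Z -> u m = 1 / (2 * n + 1)%N%:R) ->
  nabla (convolution f (zero_extension n u)) k =
  (f (k + (n%:Z + 1)) - f (k - n%:Z)) * (1 / (2 * n + 1)%N%:R)%:C%C.
Proof.
move=> u_const; rewrite /nabla !convolutionE -sumrB.
(* The sign makes the summands forward differences of [F]. *)
pose F i := - f (k + (n%:Z + 1) - i%:Z).
rewrite (eq_bigr (fun i : 'I_(2 * n + 1) =>
    (F i.+1 - F i) * (1 / (2 * n + 1)%N%:R)%:C%C)); last first.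
  move=> i _; rewrite u_const; last by have := ltn_ord i; lia.
  rewrite -mulrBl /F opprK [- _ + _]addrC.
  by congr ((f _ - f _) * _); lia.
rewrite -mulr_suml; congr (_ * _).
rewrite -(big_mkord xpredT (fun i => F i.+1 - F i)) telescope_sumr //.
by rewrite /F opprK [- _ + _]addrC; congr (f _ - f _); lia.
Qed.

(** The constant comes from [energyB_le] with two translates of [f]: the squared
    norm is at most [2 * (1 + 1) / N ^ 2] times that of [f]. *)
Lemma sup_ratio_const_le (R : realType) (n : nat) (u : int -> R) :
  (forall k : int, `|k| <= n%:Z -> u k = 1 / (2 * n + 1)%N%:R) ->
  (sup_ratio n u <= (2 / (2 * n + 1)%N%:R)%:E)%E.
Proof.
move=> u_const; apply/sup_ratio_leP => [|f _ _]; first by rewrite divr_ge0.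
rewrite (_ : nabla _ = fun k =>
  (f (k + (n%:Z + 1)) - f (k - n%:Z)) * (1 / (2 * n + 1)%N%:R)%:C%C); last first.
  by apply/funext => k; exact: nabla_conv_const.
rewrite (energyZ R (fun k => f (k + (n%:Z + 1)) - f (k - n%:Z))).
have := energyB_le R (fun k => f (k + (n%:Z + 1))) (fun k => f (k - n%:Z)).
rewrite !energy_shift => le_f.
apply: le_trans (lee_wpmul2l _ le_f) _; first by rewrite lee_fin sqr_ge0.
rewrite -mule2n -mule_natl !muleA -!EFinM.
rewrite lee_wpmul2r ?energy_ge0 // lee_fin.
by rewrite !expr_div_n le_eqVlt; apply/orP; left; apply/eqP; ring.
Qed.

(** * The sharp inequality *)

Theorem theorem1 (R : realType) (n : nat) (u : int -> R)
  (u_sym : forall k : int, `|k| <= n%:Z -> u (- k) = u k)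
  (u_sum : \sum_(i < (2 * n + 1)%N) u (i%:Z - n%:Z) = 1) :
  ((2 / (2 * n + 1)%N%:R)%:E <= sup_ratio n u)%E /\
  (sup_ratio n u = (2 / (2 * n + 1)%N%:R)%:E <->
   forall k : int, `|k| <= n%:Z -> u k = 1 / (2 * n + 1)%N%:R).
Proof.
have sup_ge : ((2 / (2 * n + 1)%N%:R)%:E <= sup_ratio n u)%E.
  have c_gt0 : 0 < 2 / (2 * n + 1)%N%:R :> R by rewrite divr_gt0 // ltr0n; lia.
  (* [sup_ratio_upper_bound_ge] needs a real nonnegative upper bound: take the
     supremum itself, or 0 when it is negative. *)
  case E : (sup_ratio n u) => [r| |]; rewrite ?leey //.
    have : 2 / (2 * n + 1)%N%:R <= Num.max r 0.
      apply: (sup_ratio_upper_bound_ge R n u) => //.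
        by rewrite le_max lexx orbT.
      by rewrite E lee_fin le_max lexx.
    by rewrite lee_fin le_max => /orP[//|]; rewrite leNgt c_gt0.
  have : 2 / (2 * n + 1)%N%:R <= 0 :> R.
    by apply: (sup_ratio_upper_bound_ge R n u) => //; rewrite E leNye.
  by rewrite leNgt c_gt0.
split=> //; split=> [sup_eq|u_const].
  by apply: const_of_sup_ratio_le => //; rewrite sup_eq.
by apply/eqP; rewrite eq_le sup_ge sup_ratio_const_le.
Qed.
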